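(* For $n\ge 0$ let $\mathcal{C}_n$ be the Catalan arrangement in $\mathbb{R}^n$, consisting of the hyperplanes $x_i-x_j=-1$, $x_i-x_j=0$ and $x_i-x_j=1$ for $1\le i<j\le n$. Let $$A_r(x)=\sum_{n=0}^{\lfloor\frac{r+1}{2}\rfloor}\binom{r-n+1}{n}x^n.$$ Then $$\sum_{n\ge 0}\chi_{\mathcal{C}_n}(q)\frac{x^n}{n!}=\left(\lim_{r\to\infty}\frac{A_r(x)}{A_{r-1}(x)}\right)^q.$$ In particular, with $C_n=\frac{1}{n+1}\binom{2n}{n}$ the $n$-th Catalan number, $$\frac{\sqrt{1+4x}-1}{2x}=\sum_{n\ge 0}(-1)^nC_nx^n=\lim_{r\to\infty}\frac{A_{r-1}(x)}{A_r(x)}.$$ The limits are in the sense of convergence of formal power series.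
   Context: For a hyperplane arrangement $\mathcal{A}$ (finite set of affine hyperplanes) in $\mathbb{R}^n$, the intersection poset $L_{\mathcal{A}}$ is the set of non-empty intersections of subsets of $\mathcal{A}$ (including the empty intersection $\hat 0=\mathbb{R}^n$), ordered by reverse inclusion; $r(x)=n-\dim x$ for $x\in L_{\mathcal{A}}$. The characteristic polynomial is $\chi_{\mathcal{A}}(q)=\sum_{x\in L_{\mathcal{A}}}\mu(\hat 0,x)\,q^{n-r(x)}$, where $\mu$ is the Möbius function of $L_{\mathcal{A}}$ (so it is $1$ for $n=0$). For a formal power series $F$ in $x$ with constant term $1$, $F^q=\exp(q\log F)$, with $q$ an indeterminate. Convergence: $\lim_{r\to\infty}F_r(x)=F(x)$ means that for every $b$ the coefficient of $x^b$ in $F_r(x)$ equals that in $F(x)$ for all sufficiently large $r$. *)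

(* Defs.v *)
From HB Require Import structures.
From mathcomp Require Import all_boot all_order all_algebra.
From mathcomp Require Import finmap.
From mathcomp Require Import boolp classical_sets reals.

Set Implicit Arguments.
Unset Strict Implicit.
Unset Printing Implicit Defensive.

Import Order.TTheory GRing.Theory Num.Theory.
Local Open Scope ring_scope.

Record fps (K : Type) := Fps { fps_coef :> nat -> K }.

HB.instance Definition _ (K : Type) := gen_eqMixin (fps K).
HB.instance Definition _ (K : Type) := gen_choiceMixin (fps K).

Lemma fpsP (K : Type) (f g : fps K) : f =1 g -> f = g.
Proof. by case: f g => [f] [g] /= /funext ->. Qed.

Definition fps_map (K L : Type) (h : K -> L) (f : fps K) : fps L :=
  Fps (fun n => h (f n)).

Section FpsRing.
Variable K : comNzRingType.
Implicit Types f g h : fps K.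

Definition fpsC (c : K) : fps K := Fps (fun n => if n == 0%N then c else 0).
Definition fpsX : fps K := Fps (fun n => (n == 1%N)%:R).

Definition fps_add f g : fps K := Fps (fun n => f n + g n).
Definition fps_opp f : fps K := Fps (fun n => - f n).
Definition fps_mul f g : fps K :=
  Fps (fun n => \sum_(i < n.+1) f i * g (n - i)%N).

Fact fps_addA : associative fps_add.
Proof. by move=> f g h; apply: fpsP => n /=; rewrite addrA. Qed.
Fact fps_addC : commutative fps_add.
Proof. by move=> f g; apply: fpsP => n /=; rewrite addrC. Qed.
Fact fps_add0 : left_id (fpsC 0) fps_add.
Proof. by move=> f; apply: fpsP => n /=; rewrite if_same add0r. Qed.
Fact fps_addN : left_inverse (fpsC 0) fps_opp fps_add.
Proof. by move=> f; apply: fpsP => n /=; rewrite if_same addNr. Qed.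

HB.instance Definition _ := GRing.isZmodule.Build (fps K)
  fps_addA fps_addC fps_add0 fps_addN.

Let trunc m f : {poly K} := \poly_(i < m) f i.

Let fps_mul_trunc m n f g : (n < m)%N ->
  fps_mul f g n = (trunc m f * trunc m g)`_n.
Proof.
move=> ltnm; rewrite coefM /=; apply: eq_bigr => i _.
rewrite !coef_poly (leq_ltn_trans _ ltnm) ?(leq_ltn_trans _ ltnm) //.
  exact: leq_subr.
by rewrite -ltnS.
Qed.

Fact fps_mulC : commutative fps_mul.
Proof. by move=> f g; apply: fpsP => n; rewrite !(@fps_mul_trunc n.+1) 1?mulrC. Qed.

Fact fps_mulA : associative fps_mul.
Proof.
move=> f g h; apply: fpsP => n.
transitivity (trunc n.+1 f * trunc n.+1 g * trunc n.+1 h)`_n.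
  rewrite -mulrA coefM /fps_mul /=; apply: eq_bigr => i _.
  have lin : (n - i < n.+1)%N by rewrite ltnS leq_subr.
  by rewrite -(fps_mul_trunc _ _ lin) coef_poly ltn_ord.
rewrite coefM /fps_mul /=; apply: eq_bigr => i _.
by rewrite -(fps_mul_trunc _ _ (ltn_ord i)) coef_poly ltnS leq_subr.
Qed.

Fact fps_mul1 : left_id (fpsC 1) fps_mul.
Proof.
move=> f; apply: fpsP => n /=; rewrite big_ord_recl /= subn0 mul1r big1 ?addr0 //.
by move=> i _; rewrite mul0r.
Qed.

Fact fps_mulDl : left_distributive fps_mul fps_add.
Proof.
move=> f g h; apply: fpsP => n /=; rewrite -big_split /=.
by apply: eq_bigr => i _; rewrite mulrDl.
Qed.

Fact fps_1neq0 : fpsC 1 != fpsC 0.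
Proof. by apply/eqP => /(congr1 (fun f : fps K => f 0%N)) /= /eqP; rewrite oner_eq0. Qed.

HB.instance Definition _ := GRing.Zmodule_isComNzRing.Build (fps K)
  fps_mulA fps_mulC fps_mul1 fps_mulDl fps_1neq0.

Lemma fps_coef0 n : (0 : fps K) n = 0.
Proof. by rewrite /= if_same. Qed.

Lemma fps_coef1 n : (1 : fps K) n = (n == 0%N)%:R.
Proof. by case: n. Qed.

Lemma fps_coefD f g n : (f + g) n = f n + g n.
Proof. by []. Qed.

Lemma fps_coefN f n : (- f) n = - f n.
Proof. by []. Qed.

Lemma fps_coefM f g n : (f * g) n = \sum_(i < n.+1) f i * g (n - i)%N.
Proof. by []. Qed.

Lemma fps_coef_sum (I : Type) (r : seq I) (P : pred I) (F : I -> fps K) n :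
  (\sum_(i <- r | P i) F i) n = \sum_(i <- r | P i) F i n.
Proof. exact: (big_morph (fun f : fps K => f n) (fun f g => erefl) (fps_coef0 n)). Qed.

(* The truncated sums in [fps_exp] and [fps_log] below rest on this fact. *)
Lemma fps_coef_expr_lt f k n : f 0%N = 0 -> (n < k)%N -> (f ^+ k) n = 0.
Proof.
move=> f0; elim: k n => // k IHk n ltnk; rewrite exprS fps_coefM big1 // => i _.
case: (posnP i) => [-> | i_gt0]; first by rewrite f0 mul0r.
rewrite IHk ?mulr0 //; case: n ltnk i => [|n] ltnk i in i_gt0 *.
  by case: i i_gt0 => [[|i] //].
by rewrite -ltnS (leq_trans _ ltnk) // ltnS ltn_subrL i_gt0.
Qed.

End FpsRing.

Section FpsUnit.
Variable K : comUnitRingType.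
Implicit Types f g h : fps K.

Definition fps_unit : {pred fps K} := fun f => f 0%N \is a GRing.unit.

Definition fps_inv f : fps K :=
  if fps_unit f then xget f [set g | g * f = 1] else f.

Let fps_inv_exists f : fps_unit f -> exists g, g * f = 1.
Proof.
move=> Uf; pose h := 1 - fpsC (f 0%N)^-1 * f.
have h0 : h 0%N = 0.
  by rewrite fps_coefD fps_coefN fps_coefM big_ord1 /= mulVr ?subrr.
pose G : fps K := Fps (fun n => \sum_(k < n.+1) (h ^+ k) n).
suff G1 : G * (1 - h) = 1.
  by exists (G * fpsC (f 0%N)^-1); rewrite -[RHS]G1 /h opprB addrC subrK mulrA.
apply: fpsP => n; transitivity (((1 - h) * \sum_(k < n.+1) h ^+ k) n).
  rewrite mulrC !fps_coefM; apply: eq_bigr => i _; congr (_ * _).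
  rewrite fps_coef_sum /= -!(big_mkord predT (fun k => (h ^+ k) (n - i)%N)).
  have le1 : ((n - i).+1 <= n.+1)%N by rewrite ltnS leq_subr.
  rewrite [RHS](big_cat_nat (leq0n _) le1) /=.
  rewrite [X in _ = _ + X]big_nat_cond [X in _ = _ + X]big1 ?addr0 //.
  by move=> k /andP[/andP[ltk _] _]; rewrite fps_coef_expr_lt.
rewrite -opprB mulNr -subrX1 fps_coefN fps_coefD fps_coefN.
by rewrite fps_coef_expr_lt // add0r opprK.
Qed.

Fact fps_mulVx : {in fps_unit, left_inverse 1 fps_inv *%R}.
Proof.
move=> f Uf; rewrite /fps_inv; have -> : fps_unit f = true by [].
by case: xgetP => [g _ //|noinv]; have [g] := fps_inv_exists Uf; move/noinv.
Qed.

Fact fps_unitPl f g : g * f = 1 -> fps_unit f.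
Proof.
move=> /(congr1 (fun h : fps K => h 0%N)); rewrite fps_coefM big_ord1 /= => gf1.
by apply/unitrP; exists (g 0%N); split=> //; rewrite mulrC.
Qed.

Fact fps_invr_out : {in [predC fps_unit], fps_inv =1 id}.
Proof. by move=> f Nf; rewrite /fps_inv; case: ifP => // Uf; case/negP: Nf. Qed.

HB.instance Definition _ := GRing.ComNzRing_hasMulInverse.Build (fps K)
  fps_mulVx fps_unitPl fps_invr_out.

Lemma fps_unitE f : (f \is a GRing.unit) = (f 0%N \is a GRing.unit).
Proof. by []. Qed.

(* [exp] of a series with constant term [0], and [log] of a series with constant
   term [1]; both make sense when the positive integers are invertible in [K].
   By [fps_coef_expr_lt], the terms of index [k > n] of the infinite sums do not
   contribute to the coefficient of [x^n]. *)
Definition fps_exp f : fps K :=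
  Fps (fun n => \sum_(0 <= k < n.+1) (k`!%:R)^-1 * (f ^+ k) n).

Definition fps_log f : fps K :=
  Fps (fun n => \sum_(1 <= k < n.+1) (-1) ^+ k.-1 / k%:R * ((f - 1) ^+ k) n).

Definition fps_sqrt f : fps K := xget 0 [set g : fps K | g 0%N = 1 /\ g ^+ 2 = f].

End FpsUnit.

Section FpsIdomain.
Variable K : idomainType.

Fact fps_idomain : GRing.integral_domain_axiom (fps K).
Proof.
move=> f g fg0; apply/orP.
have nz (h : fps K) : h != 0 -> exists n, h n != 0.
  move=> h0; apply: contrapT => /forallNP hn0; case/eqP: h0; apply: fpsP => n.
  by rewrite fps_coef0; apply/eqP; move: (hn0 n) => /negP; rewrite negbK.
case: (eqVneq f 0) => [_ | /nz exf]; first by left.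
case: (eqVneq g 0) => [_ | /nz exg]; first by right.
have [a fa mina] := ex_minnP exf; have [b gb minb] := ex_minnP exg.
have /eqP := congr1 (fun h : fps K => h (a + b)%N) fg0.
have lta : (a < (a + b).+1)%N by rewrite ltnS leq_addr.
rewrite fps_coef0 fps_coefM (bigD1 (Ordinal lta)) //= addKn big1.
  by rewrite addr0 mulf_eq0 (negPf fa) (negPf gb).
move=> i; rewrite -val_eqE /= neq_ltn => /orP[ltia | ltai].
  suff -> : f i = 0 by rewrite mul0r.
  by apply/eqP; apply: contraTT ltia => /mina; rewrite -leqNgt.
suff -> : g (a + b - i)%N = 0 by rewrite mulr0.
apply/eqP; apply: contraTT ltai => /minb; rewrite -leqNgt => leb.
have lei : (i <= a + b)%N by rewrite -ltnS.
by rewrite -(leq_add2r b) -{2}(subnKC lei) leq_add2l.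
Qed.

HB.instance Definition _ := GRing.ComUnitRing_isIntegral.Build (fps K) fps_idomain.

End FpsIdomain.

(* [F ^ q = exp (q log F)] in [Q[q][[x]]], where ['X : {poly rat}] is [q]. *)
Definition fps_powq (F : fps rat) : fps {poly rat} :=
  fps_exp (fpsC 'X * fps_log (fps_map polyC F)).

Definition fps_cvg (K : Type) (F_ : nat -> fps K) (F : fps K) : Prop :=
  forall b, exists r0, forall r, (r0 <= r)%N -> F_ r b = F b.

Lemma fps_cvg_unique (K : Type) (F_ : nat -> fps K) (F G : fps K) :
  fps_cvg F_ F -> fps_cvg F_ G -> F = G.
Proof.
move=> cvF cvG; apply: fpsP => b; have [r rF] := cvF b; have [s sG] := cvG b.
by rewrite -(rF _ (leq_maxl r s)) -(sG _ (leq_maxr r s)).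
Qed.

Section Mobius.
Context {d : Order.disp_t} {T : finPOrderType d}.
Implicit Types x y z : T.

Fixpoint mobius_rec (k : nat) x y : int :=
  if k is k'.+1 then
    if x == y then 1
    else - \sum_(z : T | (x <= z)%O && (z < y)%O) mobius_rec k' x z
  else 0.

(* [#|T|] is enough fuel: see [mobiusE]. *)
Definition mobius x y : int := mobius_rec #|T| x y.

Lemma mobiusE x y :
  mobius x y =
  if x == y then 1 else - \sum_(z : T | (x <= z)%O && (z < y)%O) mobius x z.
Proof.
have stable k l (u : T) : (#|[pred z | (z <= u)%O]| <= k)%N ->
    (#|[pred z | (z <= u)%O]| <= l)%N -> mobius_rec k x u = mobius_rec l x u.
  have pos (v : T) : (0 < #|[pred z | (z <= v)%O]|)%N.
    by apply/card_gt0P; exists v; rewrite inE.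
  elim: k l u => [|k IHk] [|l] u; try by move=> le0; have := pos u; rewrite ltnNge le0.
    by move=> _ le0; have := pos u; rewrite ltnNge le0.
  move=> lek lel /=; case: eqVneq => // _; congr (- _).
  apply: eq_bigr => z /andP[_ ltzu].
  have ltc : (#|[pred t | (t <= z)%O]| < #|[pred t | (t <= u)%O]|)%N.
    apply/proper_card/properP; split.
      by apply/fintype.subsetP => t; rewrite !inE => /le_trans; apply; apply: ltW.
    by exists u; rewrite !inE // lt_geF.
  by apply: IHk; rewrite -ltnS; apply: leq_trans ltc _.
rewrite {1}/mobius.
by rewrite (stable _ #|T|.+1) ?max_card //; apply: leqW; exact: max_card.
Qed.

End Mobius.

Section Arrangement.
Local Open Scope classical_set_scope.
Context {R : realType} {n : nat}.
Notation V := 'rV[R]_n.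

Definition is_hyperplane (H : set V) : Prop :=
  exists (a : V) (b : R),
    a != 0 /\ H = [set x : V | \sum_(i < n) a ord0 i * x ord0 i = b].

Record arrangement := Arrangement {
  hyperplanes :> {fset set V};
  hyperplanesP : forall H, H \in hyperplanes -> is_hyperplane H }.

Definition flats (A : arrangement) : {fset set V} :=
  [fset X in [fset \bigcap_(H in [set` B]) H | B : {fset set V} in fpowerset A]
     | `[< X !=set0 >]]%fset.

Lemma flatsP (A : arrangement) (X : set V) :
  reflect (exists B : {fset set V},
             [/\ (B `<=` A)%fset, X = \bigcap_(H in [set` B]) H & X !=set0])
          (X \in flats A).
Proof.
apply: (iffP idP) => [|[B [BA -> B0]]].
  rewrite !inE /= => /andP[/imfsetP[B /=]]; rewrite fpowersetE => BA XB /asboolP X0.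
  by exists B.
rewrite !inE /=; apply/andP; split; last exact/asboolP.
by apply/imfsetP; exists B; rewrite //= fpowersetE.
Qed.

(* [U] such that [X = p + U] for some point [p], if [X] is an affine subspace *)
Definition direction (X : set V) : {vspace V} :=
  xget 0%VS [set U : {vspace V} | exists p, X = [set p + u | u in [set` U]]].

Definition dimension (X : set V) : nat := \dim (direction X).

Lemma direction_unique (X : set V) (U : {vspace V}) (p : V) :
  X = [set p + u | u in [set` U]] -> direction X = U.
Proof.
move=> XU; rewrite /direction; case: xgetP => [W _ [q XW]|/(_ U)]; last first.
  by case; exists p.
have sub (a b : V) (W1 W2 : {vspace V}) :
    [set a + u | u in [set` W1]] = [set b + u | u in [set` W2]] -> (W1 <= W2)%VS.
  move=> e; apply/subvP => w wW.
  have : [set a + u | u in [set` W1]] (a + w) by exists w.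
  have : [set a + u | u in [set` W1]] a by exists 0; rewrite ?addr0 //= mem0v.
  rewrite e => -[u uW au] [v vW avw].
  have -> : w = v - u by apply: (@addrI _ a); rewrite -avw -[in RHS]au addrACA subrr addr0.
  exact: rpredB.
by apply/eqP; rewrite eqEsubv (sub q p) -?XU -?XW // (sub p q) -?XU -?XW.
Qed.

Lemma directionP (A : arrangement) (X : set V) : X \in flats A ->
  exists p, X = [set p + u | u in [set` direction X]].
Proof.
case/flatsP => B [BA XB [p Xp]].
suff [U XU] : exists U : {vspace V}, X = [set p + u | u in [set` U]].
  by exists p; rewrite (direction_unique XU).
have {BA} hypB H : H \in B -> is_hyperplane H.
  by move=> HB; apply: hyperplanesP (fsubsetP BA _ HB).
have {Xp} pB H : H \in B -> H p by rewrite XB in Xp; exact: Xp.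
suff [U BU] : exists U : {vspace V}, forall u,
    u \in U <-> forall H, H \in B -> H (p + u).
  exists U; rewrite XB; apply/seteqP; split=> [x Bx | x [u /= uU <-]].
    exists (x - p); last by rewrite addrC subrK.
    by apply/BU => H HB; rewrite addrC subrK; apply: Bx.
  exact/BU.
elim/fset1U_rect: B {XB} => [|H B _ IHB] in hypB pB *.
  by exists fullv => u; rewrite memvf; split=> // _ H; rewrite inE.
have [U BU] : exists U : {vspace V}, forall u,
    u \in U <-> forall H, H \in B -> H (p + u).
  by apply: IHB => H' HB; [apply: hypB | apply: pB]; rewrite !inE HB orbT.
have [a [b [_ HE]]] := hypB H (fset1U1 _ _).
have Hp : \sum_(i < n) a ord0 i * p ord0 i = b.
  by have := pB H (fset1U1 _ _); rewrite HE.
exists (lker (linfun (mulmxr a^T : V -> 'M[R]_1)) :&: U)%VS => u; rewrite memv_cap.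
have -> : (u \in lker (linfun (mulmxr a^T : V -> 'M[R]_1)))
    = (\sum_(i < n) a ord0 i * u ord0 i == 0).
  rewrite memv_ker lfunE /=; apply/eqP/eqP => [/matrixP/(_ ord0 ord0)|u0].
    by rewrite !mxE => u0; rewrite -[RHS]u0; apply: eq_bigr => i _; rewrite mxE mulrC.
  apply/matrixP => i j; rewrite !ord1 !mxE -[RHS]u0.
  by apply: eq_bigr => k _; rewrite mxE mulrC.
have HpuE : H (p + u) <-> \sum_(i < n) a ord0 i * u ord0 i = 0.
  have e : \sum_(i < n) a ord0 i * (p + u) ord0 i
      = b + \sum_(i < n) a ord0 i * u ord0 i.
    by rewrite -Hp -big_split /=; apply: eq_bigr => i _; rewrite mxE mulrDr.
  by rewrite HE /= e; split=> [/eqP|->]; rewrite ?addr0 // -subr_eq0 addrAC subrr add0r => /eqP.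
split=> [/andP[/eqP u0 /BU uB] H'|allH].
  by rewrite !inE => /orP[/eqP -> | /uB //]; apply/HpuE.
apply/andP; split; first by apply/eqP/HpuE; apply: allH; exact: fset1U1.
by apply/BU => H' HB; apply: allH; rewrite !inE HB orbT.
Qed.

Lemma setT_flats (A : arrangement) : [set: V] \in flats A.
Proof.
apply/flatsP; exists fset0; split; first exact: fsub0set.
  by apply/esym/seteqP; split=> // x _ H /=; rewrite inE.
by exists 0.
Qed.

Definition intersection_poset (A : arrangement) : Type := flats A.

HB.instance Definition _ A := Finite.copy (intersection_poset A) (flats A).

Definition flat_set (A : arrangement) (x : intersection_poset A) : set V := fsval x.

Definition flat_le (A : arrangement) (x y : intersection_poset A) : bool :=
  `[< flat_set y `<=` flat_set x >].

Fact flat_display : Order.disp_t. Proof. exact: Order.Disp. Qed.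

Fact flat_le_refl A : reflexive (@flat_le A).
Proof. by move=> x; apply/asboolP. Qed.

Fact flat_le_anti A : antisymmetric (@flat_le A).
Proof.
by move=> x y /andP[/asboolP xy /asboolP yx]; apply/val_inj/seteqP.
Qed.

Fact flat_le_trans A : transitive (@flat_le A).
Proof.
by move=> y x z /asboolP yx /asboolP zy; apply/asboolP => t /zy /yx.
Qed.

HB.instance Definition _ A := Order.Le_isPOrder.Build flat_display
  (intersection_poset A) (@flat_le_refl A) (@flat_le_anti A) (@flat_le_trans A).

Definition flat0 (A : arrangement) : intersection_poset A := [` setT_flats A]%fset.

Fact flat0_le A (x : intersection_poset A) : (flat0 A <= x)%O.
Proof. exact/asboolP. Qed.

HB.instance Definition _ A := Order.hasBottom.Build flat_display
  (intersection_poset A) (@flat0_le A).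

Definition flat_rank (A : arrangement) (x : intersection_poset A) : nat :=
  n - dimension (flat_set x).

Definition characteristic_polynomial (A : arrangement) : {poly int} :=
  \sum_(x : intersection_poset A)
    mobius (\bot : intersection_poset A)%O x *: 'X^(n - flat_rank x).

End Arrangement.

Arguments arrangement : clear implicits.

Section Catalan.
Context (R : realType) (n : nat).

Definition diff_hyperplane (i j : 'I_n) (c : R) : set 'rV[R]_n :=
  [set x : 'rV[R]_n | x ord0 i - x ord0 j = c]%classic.

Definition catalan_hyperplanes : {fset set 'rV[R]_n} :=
  (\bigcup_(i in 'I_n) \bigcup_(j in 'I_n | (i < j)%N)
     [fset diff_hyperplane i j (-1); diff_hyperplane i j 0;
           diff_hyperplane i j 1])%fset.

Fact catalan_hyperplanesP H : H \in catalan_hyperplanes -> is_hyperplane H.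
Proof.
case/bigfcupP => i _ /bigfcupP[j /andP[_ /andP[_ ltij]] Hc].
have [c ->] : exists c, H = diff_hyperplane i j c.
  by move: Hc; rewrite !inE -orbA => /or3P[] /eqP ->; [exists (-1) | exists 0 | exists 1].
exists (delta_mx ord0 i - delta_mx ord0 j), c; split.
  apply/eqP => /matrixP/(_ ord0 i); rewrite !mxE !eqxx -val_eqE /= (ltn_eqF ltij).
  by rewrite subr0 => /eqP; rewrite oner_eq0.
have pick (x : 'rV[R]_n) k : \sum_(l < n) (l == k)%:R * x ord0 l = x ord0 k.
  rewrite (bigD1 k) //= eqxx mul1r big1 ?addr0 // => l /negPf ->.
  by rewrite mul0r.
have E (x : 'rV[R]_n) : \sum_(k < n) (delta_mx ord0 i - delta_mx ord0 j : 'rV[R]_n) ord0 k * x ord0 k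
    = x ord0 i - x ord0 j.
  by under eq_bigr do rewrite !mxE eqxx /= mulrBl; rewrite sumrB !pick.
by apply/seteqP; split=> x; rewrite /diff_hyperplane /= E.
Qed.

Definition catalan_arrangement : arrangement R n :=
  Arrangement catalan_hyperplanesP.

End Catalan.

Definition catalan_egf (R : realType) : fps {poly rat} :=
  Fps (fun n => (n`!%:R)^-1 *:
    map_poly intr (characteristic_polynomial (catalan_arrangement R n))).

(* [n <= r] throughout the range, so the truncated subtraction is exact. *)
Definition A_series (r : nat) : fps rat :=
  \sum_(0 <= n < (r.+1)./2.+1) 'C(r - n + 1, n)%:R * fpsX rat ^+ n.

Definition catalan_number (n : nat) : rat := 'C(2 * n, n)%:R / n.+1%:R.

Definition alternating_catalan_series : fps rat :=
  Fps (fun n => (-1) ^+ n * catalan_number n).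

(* Main.v *)
(* Let c be the alternating Catalan series and F = 1 + x c, so that F^2 = F + x and
   F c = 1. As A_(r+2) = A_(r+1) + x A_r has characteristic roots F and 1 - F, one
   gets A_r = F A_(r-1) + (1 - F)^(r+1); since 1 - F has no constant term, this gives
   both limits, and F^m agrees with A_(m-1) + x A_(m-3) up to degree m - 1.

   For m > max(n, 2), a finite field argument over Z/m shows that chi_(C_n)(m) counts
   the y in (Z/m)^n whose coordinates are pairwise different and not cyclically
   adjacent, i.e. n! times the number of independent n-sets of an m-cycle. Splitting
   these sets on whether they contain a fixed vertex, their number is the coefficient
   of x^n in A_(m-1) + x A_(m-3), hence in F^m. Finally, the coefficients of exp(q log F)
   are polynomials in q which specialize to those of F^m at q = m, because both series
   satisfy F G' = m F' G. Two polynomials in q that agree at all large m are equal. *)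
Require Import Defs.
From mathcomp Require Import all_boot all_order all_algebra.
From mathcomp Require Import reals ring zify.

Set Implicit Arguments.
Unset Strict Implicit.
Unset Printing Implicit Defensive.

Import Order.TTheory GRing.Theory Num.Theory.
Local Open Scope ring_scope.

(** * Injections counted by their image, and independent sets of paths and cycles *)

Lemma card_injective_image (D T : finType) (P : pred {set T}) :
  #|[pred f : {ffun D -> T} | injectiveb f && P (f @: [set: D])]| =
  ((#|D|)`! * #|[pred S : {set T} | (#|S| == #|D|) && P S]|)%N.
Proof.
rewrite -[LHS]sum1_card.
rewrite (partition_big (fun f : {ffun D -> T} => f @: [set: D])
  [pred S : {set T} | (#|S| == #|D|) && P S]) /=; last first.
  move=> f /andP[/injectiveP injf Pf]; rewrite Pf andbT.
  by rewrite card_imset // cardsT.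
rewrite mulnC -sum_nat_const; apply: eq_bigr => S /andP[/eqP cardS PS].
(* The fibre over [S] consists of the injections into [S], which are onto by equality of
   cardinals. *)
rewrite sum1_card -[in RHS]cardS -ffactnn [in X in _ = (_ ^_ X)%N]cardS.
rewrite -card_inj_ffuns_on -cardsE; apply: eq_card => f; rewrite !inE.
apply/andP/andP => [[/andP[injf _] /eqP <-] | [/ffun_onP fS injf]].
  by split=> //; apply/ffun_onP => x; rewrite imset_f.
have fSE : f @: [set: D] = S.
  apply/eqP; rewrite eqEcard; apply/andP; split.
    by apply/fintype.subsetP => _ /imsetP[x _ ->].
  by rewrite card_imset ?cardsT ?cardS //; apply/injectiveP.
by rewrite inE fSE injf PS eqxx.
Qed.

Section Independent.
Variable k : nat.
Local Notation T := 'I_k.+3.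

Definition path_free (S : {set T}) : bool :=
  [forall a in S, forall b in S, val a != (val b).+1].

(** Addition in ['I_k.+3] wraps around, so this is independence in a cycle; [path_free] uses the
    successor of [nat]. *)
Definition cycle_free (S : {set T}) : bool :=
  [forall a in S, forall b in S, a != b + 1].

(** The window starts at a variable [a] because opening the cycle leaves paths that begin at [0] or
    at [1]. *)
Definition path_sets (a d n : nat) : pred {set T} :=
  [pred S : {set T} | [&& #|S| == n, path_free S & [forall x in S, (a <= x < a + d)%N]]].

Lemma path_freeP (S : {set T}) :
  reflect {in S &, forall a b, val a != (val b).+1} (path_free S).
Proof.
apply: (iffP forall_inP) => [F a b aS bS | F a aS].
  by have /forall_inP := F a aS; apply.
by apply/forall_inP => b; apply: F.
Qed.

Lemma cycle_freeP (S : {set T}) : reflect {in S &, forall a b, a != b + 1} (cycle_free S).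
Proof.
apply: (iffP forall_inP) => [F a b aS bS | F a aS].
  by have /forall_inP := F a aS; apply.
by apply/forall_inP => b; apply: F.
Qed.

(** Deleting [v] and adding it back are inverse bijections between the two families. *)
Lemma card_sets_with (P Q : pred {set T}) (v : T) :
  (forall S : {set T}, v \in S -> P S = Q (S :\ v)) ->
  (forall S : {set T}, Q S -> v \notin S) ->
  #|[pred S : {set T} | (v \in S) && P S]| = #|Q|.
Proof.
move=> PQ Qv.
have inj : {in Q &, injective (fun S => v |: S)}.
  by move=> S S' /Qv vS /Qv vS' /(congr1 (fun S => S :\ v)); rewrite !setU1K.
rewrite -(card_in_imset inj); apply: eq_card => S; rewrite inE.
apply/andP/imsetP => [[vS PS] | [S' QS' ->]].
  by exists (S :\ v); rewrite ?setD1K // -topredE /= -PQ.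
have vS' := Qv _ QS'.
by rewrite setU11 PQ ?setU11 // setU1K.
Qed.

(** Induction on the length: a set containing the last vertex omits the vertex before it, and the
    two cases add up by Pascal's rule. *)
Lemma card_path_sets a d n : (a + d <= k.+3)%N ->
  #|path_sets a d n| = 'C(d.+1 - n, n).
Proof.
elim/ltn_ind: d n => d IHd n led.
case: n => [|n].
  rewrite bin0 -(card1 (set0 : {set T})); apply: eq_card => S; rewrite !inE cards_eq0.
  case: eqVneq => [->|//] /=; apply/andP; split.
    by apply/path_freeP => x y; rewrite inE.
  by apply/forall_inP => x; rewrite inE.
case: d => [|d] in IHd led *.
  rewrite bin_small; last by lia.
  apply: eq_card0 => S; rewrite !inE; apply: contraTF isT.
  move=> /and3P[/eqP cS _ /forall_inP SP].
  have /card_gt0P[x /SP] : (0 < #|S|)%N by rewrite cS.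
  by lia.
have ltv : (a + d < k.+3)%N by lia.
pose v : T := Ordinal ltv.
rewrite -(cardID [pred S : {set T} | v \in S]) addnC.
have -> : #|[predD path_sets a d.+1 n.+1 & [pred S : {set T} | v \in S]]| =
    #|path_sets a d n.+1|.
  apply: eq_card => S; rewrite !inE.
  case: (boolP (v \in S)) => [vS | vS] /=.
    apply/esym/and3P => -[_ _ /forall_inP /(_ v vS)] /=; lia.
  congr [&& _, _ & _]; apply/forall_inP/forall_inP => F x xS; have := F x xS.
    have : x != v by apply: contraNneq vS => <-.
    by rewrite -val_eqE /=; lia.
  by lia.
rewrite IHd //; last by lia.
have -> : #|[predI path_sets a d.+1 n.+1 & [pred S : {set T} | v \in S]]| =
    #|path_sets a d.-1 n|.
  rewrite -(@card_sets_with (path_sets a d.+1 n.+1) _ v); first last.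
  - move=> S /and3P[_ _ /forall_inP F]; apply/negP => /F /=; lia.
  - move=> S vS; rewrite /path_sets /= (cardsD1 v S) vS add1n eqSS; congr (_ && _).
    apply/andP/andP => -[/path_freeP free /forall_inP F]; split.
    + by apply/path_freeP => x y /setD1P[_ xS] /setD1P[_ yS]; apply: free.
    + apply/forall_inP => x /setD1P[xv xS]; have := F x xS.
      have := free v x vS xS; rewrite /=; move: xv; rewrite -val_eqE /=; lia.
    + have low x : x \in S -> x != v -> (a <= x < a + d.-1)%N.
        by move=> xS xv; apply: F; rewrite !inE xv.
      apply/path_freeP => x y xS yS.
      have [-> | xv] := eqVneq x v; have [-> | yv] := eqVneq y v.
      * by rewrite /=; lia.
      * by have := low y yS yv; rewrite /=; lia.
      * by have := low x xS xv; rewrite /=; lia.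
      * by apply: free; rewrite !inE ?xv ?yv.
    + apply/forall_inP => x xS; have [-> /= | xv] := eqVneq x v; first by lia.
      have /F : x \in S :\ v by rewrite !inE xv.
      by lia.
  by apply: eq_card => S; rewrite !inE andbC.
(* In a window of one vertex, [v] has no predecessor to exclude and [d.-1] is the truncated [0]. *)
case: d => [|d] in IHd led ltv v *; rewrite IHd; try by lia.
  by case: n => [|n]; rewrite ?bin0 ?subSS ?sub0n ?bin0n //= bin_small.
rewrite /= !subSS.
case: (leqP n d.+1) => [le | lt]; first by rewrite (subSn le) binS addnC.
by rewrite !bin_small; lia.
Qed.

Lemma val_add1 (b : T) : val (b + 1) = (if b.+1 == k.+3 then 0 else b.+1)%N.
Proof.
rewrite /= addn1; case: eqVneq => [-> | ne]; first by rewrite modnn.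
by rewrite modn_small // ltn_neqAle ne ltn_ord.
Qed.

(** Without [ord_max] the cycle becomes a path on [k.+2] vertices. A set containing [ord_max] omits
    its neighbours [0] and [k.+1], which leaves the path from [1] to [k]. *)
Lemma card_cycle_sets n :
  #|[pred S : {set T} | (#|S| == n) && cycle_free S]| =
  ('C(k.+3 - n, n) + if n is n'.+1 then 'C(k.+1 - n', n') else 0)%N.
Proof.
rewrite -(cardID [pred S : {set T} | ord_max \in S]) addnC; congr (_ + _)%N.
  rewrite -(@card_path_sets 0 k.+2) //; apply: eq_card => S; rewrite !inE.
  case: (boolP (ord_max \in S)) => [vS | vS] /=.
    by apply/esym/and3P => -[_ _ /forall_inP /(_ _ vS)] /=; lia.
  have low x : x \in S -> (x < k.+2)%N.
    move=> xS; have : x != ord_max by apply: contraNneq vS => <-.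
    by rewrite -val_eqE /=; have := ltn_ord x; lia.
  have succ b : b \in S -> (b.+1 == k.+3) = false by move/low; lia.
  congr (_ && _); apply/cycle_freeP/andP => [F | [/path_freeP F _] a b aS bS].
    split; last by apply/forall_inP.
    apply/path_freeP => a b aS bS; have := F a b aS bS.
    by rewrite -val_eqE val_add1 succ.
  by rewrite -val_eqE val_add1 succ ?F.
case: n => [|n].
  apply: eq_card0 => S; rewrite !inE; apply/negP => /andP[/andP[/eqP S0 _]].
  by rewrite (cards0_eq S0) inE.
rewrite -(@card_path_sets 1 k); last by lia.
rewrite -(@card_sets_with [pred S : {set T} | (#|S| == n.+1) && cycle_free S] _ ord_max).
- by apply: eq_card => S; rewrite !inE andbC.
- move=> S vS; rewrite /path_sets /= (cardsD1 ord_max S) vS add1n eqSS; congr (_ && _).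
  apply/cycle_freeP/andP => [F | [/path_freeP free /forall_inP F]].
    have low x : x \in S :\ ord_max -> (1 <= x < 1 + k)%N.
      move=> /setD1P[xv xS]; have := F _ _ vS xS; have := F _ _ xS vS.
      rewrite -!val_eqE !val_add1; move: xv; rewrite -val_eqE /= eqxx.
      by have := ltn_ord x; case: (x.+1 =P k.+3); lia.
    split; last by apply/forall_inP.
    apply/path_freeP => a b aS bS; have := low b bS.
    move/setD1P: aS => [_ aS]; move/setD1P: bS => [_ bS]; have := F a b aS bS.
    by rewrite -val_eqE val_add1 /=; case: (b.+1 =P k.+3); lia.
  have low x : x \in S -> x != ord_max -> (1 <= x < 1 + k)%N.
    by move=> xS xv; apply: F; rewrite !inE xv.
  move=> a b aS bS; rewrite -val_eqE val_add1.
  have [-> | av] := eqVneq a ord_max; have [-> | bv] := eqVneq b ord_max.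
  + by rewrite /= eqxx.
  + by have := low b bS bv; rewrite /=; case: (b.+1 =P k.+3); lia.
  + by have := low a aS av; rewrite /= eqxx; lia.
  + have := free a b; rewrite !inE av bv aS bS => /(_ isT isT).
    by have := low b bS bv; rewrite /=; case: (b.+1 =P k.+3); lia.
- by move=> S /and3P[_ _ /forall_inP F]; apply/negP => /F /=; lia.
Qed.

(** The condition says that [y] is injective with [cycle_free] image. Testing the difference [1]
    alone suffices, since [(i, j)] and [(j, i)] both occur. *)
Lemma card_separated_tuples n :
  #|[pred y : {ffun 'I_n -> T} | [forall i, forall j, (i != j) ==>
       (y i != y j) && (y i - y j != 1)]]| =
  (n`! * ('C(k.+3 - n, n) + if n is n'.+1 then 'C(k.+1 - n', n') else 0))%N.
Proof.
rewrite -card_cycle_sets -[in RHS](card_ord n) -card_injective_image.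
apply: eq_card => y; rewrite !inE; apply/forallP/andP.
  move=> sep; split.
    apply/injectiveP => i j yij; apply: contraTeq isT => neij.
    by have /forallP/(_ j)/implyP/(_ neij) := sep i; rewrite yij eqxx.
  apply/cycle_freeP => _ _ /imsetP[i _ ->] /imsetP[j _ ->].
  have [-> | neij] := eqVneq i j.
    by rewrite -subr_eq0 opprD addNKr oppr_eq0 oner_eq0.
  have /forallP/(_ j)/implyP/(_ neij)/andP[_] := sep i.
  by rewrite subr_eq addrC.
move=> [/injectiveP injy /cycle_freeP free] i; apply/forallP => j; apply/implyP => neij.
rewrite (inj_eq injy) neij subr_eq addrC /=.
by apply: free; rewrite imset_f.
Qed.

End Independent.

From mathcomp Require Import finmap boolp classical_sets.

(** * Coefficients and formal derivatives of power series *)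

Section FpsDeriv.
Variable K : comNzRingType.
Implicit Types f g h : fps K.

Lemma fps_coef0M f g : (f * g) 0%N = f 0%N * g 0%N.
Proof. by rewrite fps_coefM big_ord1. Qed.

Lemma fps_coef0X f k : (f ^+ k) 0%N = f 0%N ^+ k.
Proof. by elim: k => // k IHk; rewrite !exprS fps_coef0M IHk. Qed.

Lemma fps_coefXM f n : (fpsX K * f) n = if n is n'.+1 then f n' else 0.
Proof.
rewrite fps_coefM big_ord_recl /= mul0r add0r; case: n => [|n]; first by rewrite big_ord0.
rewrite big_ord_recl /= mul1r subn1 /= big1 ?addr0 // => i _.
by rewrite /bump /= mul0r.
Qed.

Lemma fps_coefCM c f n : (fpsC c * f) n = c * f n.
Proof.
rewrite fps_coefM big_ord_recl /= subn0 big1 ?addr0 // => i _.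
by rewrite mul0r.
Qed.

Lemma fps_coefMn f k n : (f *+ k) n = f n *+ k.
Proof. by elim: k => [|k IHk]; rewrite ?mulr0n ?fps_coef0 // !mulrS fps_coefD IHk. Qed.

Lemma eq_fps_coefM f g h n :
  (forall i, (i <= n)%N -> g i = h i) -> (f * g) n = (f * h) n.
Proof.
by move=> gh; rewrite !fps_coefM; apply: eq_bigr => i _; rewrite gh ?leq_subr.
Qed.

Lemma fps_coefM_expr_lt f g k n : f 0%N = 0 -> (n < k)%N -> (g * f ^+ k) n = 0.
Proof.
move=> f0 ltnk; rewrite -[RHS](fps_coef0 K n) -(mulr0 g).
apply: eq_fps_coefM => i lein; rewrite fps_coef0 fps_coef_expr_lt //.
exact: leq_ltn_trans ltnk.
Qed.

Definition fps_deriv f : fps K := Fps (fun n => f n.+1 *+ n.+1).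

Lemma fps_coef_deriv f n : fps_deriv f n = f n.+1 *+ n.+1.
Proof. by []. Qed.

Lemma fps_derivD f g : fps_deriv (f + g) = fps_deriv f + fps_deriv g.
Proof. by apply: fpsP => n; rewrite fps_coefD /= mulrnDl. Qed.

Lemma fps_derivB f g : fps_deriv (f - g) = fps_deriv f - fps_deriv g.
Proof. by apply: fpsP => n; rewrite fps_coefD fps_coefN /= mulrnBl. Qed.

Lemma fps_deriv1 : fps_deriv 1 = 0.
Proof. by apply: fpsP => n; rewrite fps_coef0 /= mul0rn. Qed.

Lemma fps_derivX : fps_deriv (fpsX K) = 1.
Proof. by apply: fpsP => -[|n]; rewrite fps_coef1 //= mul0rn. Qed.

Lemma fps_derivM f g : fps_deriv (f * g) = fps_deriv f * g + f * fps_deriv g.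
Proof.
apply: fpsP => n; rewrite fps_coefD [LHS]/= !fps_coefM /= -sumrMnl.
transitivity (\sum_(i < n.+2) (f i *+ i * g (n.+1 - i)%N
    + f i * (g (n.+1 - i)%N *+ (n.+1 - i)))).
  apply: eq_bigr => i _; rewrite mulrnAl mulrnAr -mulrnDr subnKC //.
  by rewrite -ltnS.
rewrite big_split /=; congr (_ + _).
  rewrite big_ord_recl /= mulr0n mul0r add0r; apply: eq_bigr => i _.
  by rewrite /bump /= add1n subSS.
rewrite big_ord_recr /= subnn mulr0n mulr0 addr0; apply: eq_bigr => i _.
by rewrite subSn // -ltnS.
Qed.

Lemma fps_derivC c f : fps_deriv (fpsC c * f) = fpsC c * fps_deriv f.
Proof. by apply: fpsP => n; rewrite fps_coef_deriv !fps_coefCM mulrnAr. Qed.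

Lemma fps_deriv_exp f k : fps_deriv (f ^+ k.+1) = fps_deriv f * f ^+ k *+ k.+1.
Proof.
elim: k => [|k IHk]; first by rewrite expr1 mulr1.
by rewrite exprS fps_derivM IHk mulrnAr mulrCA -exprS [RHS]mulrS.
Qed.

End FpsDeriv.

(** * Differential equations of the exponential, the logarithm and the power [F ^ q] *)

Section FpsExpLog.
Variable K : comUnitRingType.
Hypothesis natK_unit : forall k, (k.+1%:R : K) \is a GRing.unit.
Implicit Types f g : fps K.

(** Raising the truncation bound lets one finite sum serve all coefficients up to a given degree. *)
Lemma fps_expE f n N : f 0%N = 0 -> (n < N)%N ->
  fps_exp f n = \sum_(0 <= k < N) (k`!%:R)^-1 * (f ^+ k) n.
Proof.
move=> f0 ltnN; rewrite [RHS](big_cat_nat (leq0n _) ltnN) /=.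
rewrite [X in _ = _ + X]big_nat_cond [X in _ = _ + X]big1 ?addr0 //.
by move=> k /andP[/andP[ltnk _] _]; rewrite fps_coef_expr_lt ?mulr0.
Qed.

Lemma fps_exp_coef0 f : fps_exp f 0%N = 1.
Proof. by rewrite /= big_nat1 expr0 invr1 mul1r. Qed.

Lemma fps_deriv_fps_exp f : f 0%N = 0 ->
  fps_deriv (fps_exp f) = fps_deriv f * fps_exp f.
Proof.
move=> f0; apply: fpsP => n.
transitivity ((fps_deriv f * \sum_(0 <= k < n.+1) fpsC (k`!%:R)^-1 * f ^+ k) n).
  rewrite [LHS]/= -sumrMnl big_nat_recl // expr0 mulr0 mul0rn add0r.
  rewrite mulr_sumr fps_coef_sum; apply: eq_bigr => k _.
  rewrite -mulrnAr -[X in _ * X]/(fps_deriv (f ^+ k.+1) n) fps_deriv_exp.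
  rewrite fps_coefMn mulrCA fps_coefCM -[X in _ * X = _]mulr_natl mulrA; congr (_ * _).
  have Uk : (k`!%:R : K) \is a GRing.unit.
    by rewrite -(prednK (fact_gt0 k)).
  by rewrite factS natrM invrM // -mulrA mulVr ?mulr1.
apply: eq_fps_coefM => i lein; rewrite fps_coef_sum (@fps_expE _ _ n.+1) //.
by apply: eq_bigr => k _; rewrite fps_coefCM.
Qed.

Lemma fps_log_coef0 f : fps_log f 0%N = 0.
Proof. by rewrite /= big_nil. Qed.

(** Differentiating termwise gives [f'] times the geometric series in [- h], whose truncation
    inverts [f = 1 + h] up to degree [n]. *)
Lemma fps_deriv_fps_log f : f 0%N = 1 ->
  f * fps_deriv (fps_log f) = fps_deriv f.
Proof.
move=> f1; pose h := f - 1.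
have h0 : h 0%N = 0 by rewrite fps_coefD fps_coefN f1 subrr.
have logE i n : (i <= n)%N ->
    fps_deriv (fps_log f) i = (fps_deriv f * \sum_(0 <= k < n.+1) (- h) ^+ k) i.
  move=> lein; transitivity ((fps_deriv f * \sum_(0 <= k < i.+1) (- h) ^+ k) i).
    rewrite [LHS]/= -sumrMnl big_add1 [LHS]/= mulr_sumr fps_coef_sum.
    apply: eq_bigr => k _; rewrite -mulrnAr.
    rewrite -[X in _ * X]/(fps_deriv (h ^+ k.+1) i) fps_deriv_exp.
    rewrite fps_coefMn -[X in _ * X]mulr_natl mulrA mulrVK //.
    rewrite fps_derivB fps_deriv1 subr0 [(- h) ^+ _]exprNn -signr_odd -[in RHS]signr_odd.
    by case: (odd k); rewrite ?expr0 ?expr1 ?mul1r // !mulN1r mulrN fps_coefN.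
  have le1 : (i.+1 <= n.+1)%N by [].
  have -> : \sum_(0 <= k < n.+1) (- h) ^+ k =
      \sum_(0 <= k < i.+1) (- h) ^+ k + \sum_(i.+1 <= k < n.+1) (- h) ^+ k.
    by rewrite (big_cat_nat (leq0n _) le1).
  rewrite mulrDr fps_coefD [X in _ = _ + fps_coef X i]mulr_sumr fps_coef_sum.
  rewrite [X in _ = _ + X]big_nat_cond [X in _ = _ + X]big1 ?addr0 //.
  move=> k /andP[/andP[ltik _] _].
  by rewrite fps_coefM_expr_lt // fps_coefN h0 oppr0.
apply: fpsP => n.
rewrite (eq_fps_coefM f (fun i => @logE i n)) mulrCA.
have -> : f * \sum_(0 <= k < n.+1) (- h) ^+ k = 1 - (- h) ^+ n.+1.
  have -> : f = - (- h - 1) by rewrite /h !opprB addrC subrK.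
  by rewrite big_mkord mulNr -subrX1 opprB.
rewrite mulrBr mulr1 fps_coefD fps_coefN.
by rewrite fps_coefM_expr_lt ?subr0 // fps_coefN h0 oppr0.
Qed.

End FpsExpLog.

(** The equation expresses [n.+1] times the next coefficient through the earlier ones. Applied to a
    difference, this is uniqueness for first-order linear equations. *)
Lemma fps_ode0 (K : numDomainType) (f g : fps K) :
  f 0%N = 0 -> fps_deriv f = g * f -> f = 0.
Proof.
move=> f0 df; apply: fpsP => n; rewrite fps_coef0.
elim/ltn_ind: n => -[//|n] IHn; apply/eqP.
have /eqP : fps_deriv f n = 0.
  rewrite df fps_coefM big1 // => i _.
  by rewrite IHn ?mulr0 // ltnS leq_subr.
by rewrite /= mulrn_eq0.
Qed.

Section FpsMap.
Variables (K L : comNzRingType) (h : {rmorphism K -> L}).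

Lemma fps_mapM f g : fps_map h (f * g) = fps_map h f * fps_map h g.
Proof.
apply: fpsP => n /=; rewrite rmorph_sum.
by apply: eq_bigr => i _; rewrite rmorphM.
Qed.

Lemma fps_map_deriv f : fps_map h (fps_deriv f) = fps_deriv (fps_map h f).
Proof. by apply: fpsP => n /=; rewrite rmorphMn. Qed.

End FpsMap.

Lemma fps_powq_horner (F : fps rat) (m : nat) : F 0%N = 1 ->
  fps_map (horner_eval m%:R) (fps_powq F) = F ^+ m.
Proof.
move=> F1; set FX := fps_map polyC F; set G := fps_powq F.
pose ev : {poly rat} -> rat := horner_eval m%:R.
have UK k : (k.+1%:R : {poly rat}) \is a GRing.unit.
  by rewrite -polyC_natr poly_unitE size_polyC coefC eqxx unitfE pnatr_eq0.
have UF : F \is a GRing.unit by rewrite fps_unitE F1 unitr1.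
have FX1 : FX 0%N = 1 by rewrite /= F1.
have evF : fps_map ev FX = F by apply: fpsP => n; rewrite /= /ev horner_evalE hornerC.
have dG : FX * fps_deriv G = fpsC 'X * (fps_deriv FX * G).
  rewrite /G /fps_powq -/FX fps_deriv_fps_exp //; last first.
    by rewrite fps_coef0M fps_log_coef0 mulr0.
  by rewrite fps_derivC !mulrA [FX * _]mulrC -!mulrA (mulrA FX) fps_deriv_fps_log.
have /(congr1 (fps_map ev)) := dG; rewrite !fps_mapM !fps_map_deriv evF.
have -> : fps_map ev (fpsC 'X) = fpsC m%:R.
  by apply: fpsP => -[|n]; rewrite /= /ev horner_evalE ?hornerX ?horner0.
set H := fps_map ev G => dH.
have dFm : F * fps_deriv (F ^+ m) = fpsC m%:R * (fps_deriv F * F ^+ m).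
  case: m {ev evF dH H} => [|m].
    rewrite expr0 fps_deriv1 mulr0; apply: fpsP => n.
    by rewrite fps_coefCM mul0r fps_coef0.
  rewrite fps_deriv_exp mulrnAr mulrCA -exprS; apply: fpsP => n.
  by rewrite fps_coefCM fps_coefMn mulr_natl.
apply/eqP; rewrite -subr_eq0; apply/eqP.
(* Dividing by the unit [F] brings the common equation into the form required by [fps_ode0]. *)
apply: (@fps_ode0 _ _ (fpsC m%:R * fps_deriv F / F)).
  rewrite fps_coefD fps_coefN fps_coef0X F1 expr1n -[X in X - _]/(ev (G 0%N)).
  by rewrite /G /fps_powq fps_exp_coef0 /ev horner_evalE hornerC subrr.
apply: (mulrI UF); rewrite fps_derivB mulrBr dH dFm -!mulrBr.
by rewrite [RHS]mulrA [F * _]mulrC divrK // -mulrA.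
Qed.

(** * The alternating Catalan series and the ratios of consecutive [A_series] *)

Section CatalanSeries.
Local Notation x := (fpsX rat).
Local Notation c := alternating_catalan_series.

(** This ratio of consecutive Catalan numbers yields the differential equation of [s]. *)
Lemma catalan_number_rec k :
  k.+2%:R * catalan_number k.+1 = 2 * (2 * k + 1)%:R * catalan_number k.
Proof.
have binE : (k.+1 * 'C(2 * k.+1, k.+1) = 2 * (2 * k + 1) * 'C(2 * k, k))%N.
  have sym : 'C((2 * k).+1, k) = 'C((2 * k).+1, k.+1).
    by rewrite -bin_sub; [congr 'C(_, _); lia | lia].
  rewrite (_ : 2 * k.+1 = (2 * k).+2)%N; last by lia.
  rewrite -mul_bin_diag /= sym (_ : (2 * k).+2 = 2 * k.+1)%N; last by lia.
  by rewrite -mulnA -mul_bin_diag /= mulnA addn1.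
have k1 : (k.+1%:R : rat) != 0 by rewrite pnatr_eq0.
have k2 : (k.+2%:R : rat) != 0 by rewrite pnatr_eq0.
rewrite /catalan_number [X in X = _]mulrC divfK // mulrA -natrM -natrM -binE natrM.
by rewrite mulrC mulKf.
Qed.

Let s : fps rat := 1 + 2%:R * x * c.

Let s0 : s 0%N = 1.
Proof. by rewrite /s fps_coefD fps_coef1 -mulrA mulrCA fps_coefXM addr0. Qed.

(* [(1 + 4 x) s' = 2 s], so [s ^ 2] and [1 + 4 x] solve the same linear
   differential equation [(1 + 4 x) f' = 4 f]. *)
Let s_sqr : s ^+ 2 = 1 + 4%:R * x.
Proof.
have sS n : s n.+1 = 2 * c n.
  rewrite /s fps_coefD fps_coef1 add0r -mulrA (_ : 2%:R = fpsC 2).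
    by rewrite fps_coefCM fps_coefXM.
  by apply: fpsP => -[|m]; rewrite fps_coefMn fps_coef1 ?mul0rn.
have cE n : c n = (-1) ^+ n * catalan_number n by [].
have four : (4%:R : fps rat) = fpsC 4.
  by apply: fpsP => -[|m]; rewrite fps_coefMn fps_coef1 ?mul0rn.
have ds : (1 + 4%:R * x) * fps_deriv s = 2%:R * s.
  apply: fpsP => n; rewrite mulrDl mul1r four -mulrA fps_coefD fps_coefCM fps_coefXM.
  rewrite mulr_natl fps_coefMn; case: n => [|n]; rewrite fps_coef_deriv sS.
    by rewrite mulr0 addr0 s0 cE expr0 mul1r mulr1n /catalan_number muln0 bin0.
  rewrite fps_coef_deriv sS !cE exprS.
  have -> (e v : rat) : 2 * (-1 * e * v) *+ n.+2 = - 2 * e * (n.+2%:R * v) by ring.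
  by rewrite catalan_number_rec; ring.
have U : 1 + 4%:R * x \is a GRing.unit.
  by rewrite fps_unitE fps_coefD fps_coef1 mulrC fps_coefXM addr0 unitr1.
have d4 : fps_deriv (1 + 4%:R * x) = 4%:R.
  by rewrite fps_derivD fps_deriv1 four fps_derivC fps_derivX mulr1 add0r.
apply/eqP; rewrite -subr_eq0; apply/eqP.
apply: (@fps_ode0 _ _ (4%:R / (1 + 4%:R * x))).
  rewrite fps_coefD fps_coefN fps_coef0X s0 fps_coefD fps_coef1.
  by rewrite [4%:R * _]mulrC fps_coefXM addr0 subrr.
apply: (mulrI U); rewrite mulrA mulrCA mulrV // mulr1.
rewrite fps_derivB d4 expr2 fps_derivM.
have -> (d : fps rat) : (1 + 4%:R * x) * (d * s + s * d - 4%:R) =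
  2%:R * s * ((1 + 4%:R * x) * d) - 4%:R * (1 + 4%:R * x) by ring.
by rewrite ds; ring.
Qed.

(** Expand [s_sqr] and cancel [4 x], which is allowed because the series form an integral domain. *)
Lemma alternating_catalan_eq : c = 1 - x * c ^+ 2.
Proof.
have x4 : 4%:R * x != 0.
  apply/eqP => /(congr1 (fun f : fps rat => f 1%N)).
  by rewrite mulrC fps_coefXM fps_coef0 fps_coefMn fps_coef1.
apply: (mulfI x4); have := s_sqr; rewrite /s => sE.
have -> : 4%:R * x * c = (1 + 2%:R * x * c) ^+ 2 - 1 - 4%:R * x * (x * c ^+ 2) by ring.
by rewrite sE; ring.
Qed.

(** In an integral domain a square root of [s ^ 2] is [s] or [- s]; the constant term [1] selects
    [s]. *)
Lemma fps_sqrt_catalan : fps_sqrt (1 + 4%:R * x) = 1 + 2%:R * x * c.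
Proof.
rewrite /fps_sqrt; case: xgetP => [g _ [g0 gE] | /(_ s) []]; last by [].
have /eqP : (g - s) * (g + s) = 0 by rewrite -subr_sqr gE s_sqr subrr.
rewrite mulf_eq0 => /orP[]; first by rewrite subr_eq0 => /eqP.
move/eqP/(congr1 (fun f : fps rat => f 0%N)).
by rewrite fps_coefD g0 s0 fps_coef0.
Qed.

(** The division takes place in the fraction field because [2 x] is not a unit among the series. *)
Lemma sqrt_catalan_quotient :
  tofrac (fps_sqrt (1 + 4%:R * x) - 1) / tofrac (2%:R * x) = tofrac c.
Proof.
have x2 : 2%:R * x != 0.
  apply/eqP => /(congr1 (fun f : fps rat => f 1%N)).
  by rewrite mulrC fps_coefXM fps_coef0 fps_coefMn fps_coef1.
by rewrite fps_sqrt_catalan addrC addKr tofracM mulrAC mulfV ?mul1r // tofrac_eq0.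
Qed.

(** This is [(1 + sqrt (1 + 4 x)) / 2], the root with constant term [1] of [T ^ 2 = T + x]. *)
Definition catalan_root : fps rat := 1 + x * c.
Local Notation F := catalan_root.

Lemma catalan_root_coef0 : F 0%N = 1.
Proof. by rewrite fps_coefD fps_coef1 fps_coefXM addr0. Qed.

Lemma catalan_root_sqr : F ^+ 2 = F + x.
Proof.
rewrite /F; have cE := alternating_catalan_eq.
have -> : (1 + x * c) ^+ 2 = 1 + 2%:R * x * c + x * (1 - (1 - x * c ^+ 2)) by ring.
by rewrite -cE; ring.
Qed.

Lemma catalan_root_inv : F * c = 1.
Proof.
have cE := alternating_catalan_eq; rewrite /F.
have -> : (1 + x * c) * c = c + (1 - (1 - x * c ^+ 2)) by ring.
by rewrite -cE; ring.
Qed.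

(** Beyond the range of the sum the binomial coefficient vanishes, even where the subtraction
    truncates, so one formula covers all degrees. *)
Lemma A_series_coef r n : A_series r n = 'C(r.+1 - n, n)%:R.
Proof.
have xn k m : (x ^+ k) m = (m == k)%:R.
  elim: k m => [|k IHk] m; first by rewrite expr0 fps_coef1.
  by rewrite exprS fps_coefXM; case: m => [|m] //; rewrite IHk eqSS.
rewrite /A_series fps_coef_sum.
have coefE k : ('C(r - k + 1, k)%:R * x ^+ k) n = ((n == k) * 'C(r - k + 1, k))%:R.
  by rewrite mulr_natl fps_coefMn xn mulnC -mulrnA mulnC.
under eq_bigr do rewrite coefE.
case: (ltnP n (r.+1)./2.+1) => [ltn | len].
  rewrite (bigD1_seq n) ?mem_index_iota ?iota_uniq //= eqxx mul1n big1 ?addr0.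
    by congr ('C(_, _)%:R); lia.
  by move=> k /negPf; rewrite eq_sym => ->.
rewrite big_nat_cond big1 => [|k /andP[/andP[_ ltk] _]].
  by rewrite bin_small //; lia.
by rewrite gtn_eqF // (leq_trans ltk).
Qed.

Lemma A_series0 : A_series 0 = 1.
Proof.
apply: fpsP => n; rewrite A_series_coef fps_coef1.
by case: n => [|[|n]]; rewrite ?bin0 ?bin0n ?subSS ?sub0n.
Qed.

Lemma A_series1 : A_series 1 = 1 + x.
Proof.
apply: fpsP => n; rewrite A_series_coef fps_coefD fps_coef1 /=.
by case: n => [|[|[|n]]]; rewrite ?bin0 ?bin0n ?subSS ?sub0n ?add0r ?addr0.
Qed.

(** Pascal's rule in each degree; where the subtraction truncates, both sides are zero. *)
Lemma A_series_rec r : A_series r.+2 = A_series r.+1 + x * A_series r.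
Proof.
apply: fpsP => n; rewrite fps_coefD fps_coefXM !A_series_coef.
case: n => [|n]; first by rewrite !bin0 addr0.
case: (leqP n r.+1) => [le | lt]; last first.
  by rewrite A_series_coef !bin_small ?addr0 //; lia.
rewrite A_series_coef (_ : (r.+3 - n.+1 = (r.+1 - n).+1)%N); last by lia.
by rewrite binS natrD subSS.
Qed.

(* The recursion has characteristic roots [F] and [1 - F]. *)
Lemma A_series_root r : A_series r.+1 = F * A_series r + (1 - F) ^+ r.+2.
Proof.
have FE := catalan_root_sqr.
have xE : x = F ^+ 2 - F by rewrite FE; ring.
elim: r => [|r IHr].
  by rewrite A_series0 A_series1 xE; ring.
have E : (1 - F) ^+ r.+2 = A_series r.+1 - F * A_series r.
  by rewrite IHr addrAC subrr add0r.
by rewrite A_series_rec exprS E xE; ring.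
Qed.

Lemma A_series_unit r : A_series r \is a GRing.unit.
Proof. by rewrite fps_unitE A_series_coef bin0 unitr1. Qed.

Lemma one_sub_catalan_root0 : (1 - F) 0%N = 0.
Proof. by rewrite fps_coefD fps_coefN fps_coef1 catalan_root_coef0 subrr. Qed.

Lemma A_series_ratio_cvg : fps_cvg (fun r => A_series r / A_series r.-1) F.
Proof.
(* The bound excludes [r = 0], where [r.-1] truncates. The error is a multiple of [(1 - F) ^ r.+2],
   invisible in degree [b]. *)
move=> b; exists b.+1 => -[//|r] ltbr.
rewrite succnK A_series_root mulrDl mulrK ?A_series_unit //.
rewrite fps_coefD [_ / _]mulrC fps_coefM_expr_lt ?addr0 //.
  exact: one_sub_catalan_root0.
exact: leqW.
Qed.

Lemma A_series_inv_ratio_cvg : fps_cvg (fun r => A_series r.-1 / A_series r) c.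
Proof.
move=> b; exists b.+1 => -[//|r] ltbr; rewrite succnK.
(* Multiplying [A_series_root] by [c], the inverse of [F], solves it for [A_series r]. *)
have -> : A_series r / A_series r.+1 =
    c - c / A_series r.+1 * (1 - F) ^+ r.+2.
  apply: (mulIr (A_series_unit r.+1)); rewrite divrK ?A_series_unit //.
  set P := (1 - F) ^+ r.+2; rewrite mulrBl [c / _ * P]mulrAC divrK ?A_series_unit //.
  rewrite A_series_root mulrDr mulrA [c * F]mulrC catalan_root_inv mul1r.
  by rewrite addrK.
rewrite fps_coefD fps_coefN fps_coefM_expr_lt ?subr0 //.
  exact: one_sub_catalan_root0.
exact: leqW.
Qed.

(** Reducing powers of [F] by [F ^ 2 = F + x] produces coefficients that obey the recursion of
    [A_series]. *)
Lemma catalan_root_exp m :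
  F ^+ m.+3 = F * A_series m.+1 + x * A_series m.
Proof.
have FE := catalan_root_sqr.
elim: m => [|m IHm].
  by rewrite A_series0 A_series1 exprS FE mulrDr -expr2 FE; ring.
rewrite exprS IHm mulrDr mulrA -expr2 FE A_series_rec; ring.
Qed.

(** Replacing [F * A_series k.+1] by [A_series k.+2] changes only degrees from [k.+3] on. The right
    side then matches the count in [card_cycle_sets]. *)
Lemma catalan_root_exp_coef k n : (n < k.+3)%N ->
  (F ^+ k.+3) n = (A_series k.+2 + x * A_series k) n.
Proof.
move=> ltn; rewrite catalan_root_exp [in RHS]A_series_root.
rewrite [in RHS]addrAC [in RHS]fps_coefD.
rewrite (_ : ((1 - F) ^+ k.+3) n = 0) ?addr0 //.
by rewrite fps_coef_expr_lt // one_sub_catalan_root0.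
Qed.

End CatalanSeries.

(** * Moebius sums and the finite field method *)

Lemma sum_mobius_le (d : Order.disp_t) (T : finBPOrderType d) (x : T) :
  \sum_(z : T | (z <= x)%O) mobius \bot%O z = (x == \bot%O)%:R.
Proof.
rewrite (bigD1 x) //= mobiusE eq_sym; case: eqVneq => [-> | xN0].
  rewrite big1 ?addr0 // => z /andP[z0 zN0].
  by rewrite lex0 in z0; rewrite z0 in zN0.
rewrite addrC; apply/eqP; rewrite subr_eq0; apply/eqP/eq_bigl => z.
by rewrite le0x lt_neqAle andbC.
Qed.

Section FiniteFieldMethod.
Local Open Scope classical_set_scope.
Variables (R : realType) (n : nat) (A : arrangement R n).
Local Notation V := 'rV[R]_n.
Local Notation L := (intersection_poset A).

Lemma bigcap_flat (p : V) (B : {fset set V}) :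
  (B `<=` A)%fset -> (forall H, H \in B -> H p) ->
  \bigcap_(H in [set` B]) H \in flats A.
Proof. by move=> BA Bp; apply/flatsP; exists B; split=> //; exists p => H; apply: Bp. Qed.

(** The witness is the intersection of all hyperplanes through [p], so the flats through [p] form an
    interval from the bottom. *)
Lemma flat_of_point (p : V) : exists x : L,
  (forall z : L, (z <= x)%O <-> flat_set z p) /\
  (x = \bot%O <-> forall H, H \in hyperplanes A -> ~ H p).
Proof.
pose B := [fset H in hyperplanes A | `[< H p >]]%fset.
have BP H : (H \in B) = (H \in hyperplanes A) && `[< H p >] by rewrite !inE.
have BA : (B `<=` A)%fset by apply/fsubsetP => H; rewrite BP => /andP[].
have Bp H : H \in B -> H p by rewrite BP => /andP[_ /asboolP].
have XL := bigcap_flat BA Bp.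
exists [` XL]%fset; split=> [z|]; first split.
- by move/asboolP; apply => /= H; apply: Bp.
- case: z => Z ZL; rewrite /flat_set /= => Zp; apply/asboolP.
  rewrite /flat_set /= => q Xq.
  have /flatsP[C [CA ZC _]] := ZL; rewrite ZC => H HC; apply: Xq => /=.
  rewrite BP (fsubsetP CA _ HC); apply/asboolP.
  by rewrite ZC in Zp; apply: Zp.
- split=> [/(congr1 (@flat_set _ _ A)) X0 H HA Hp | noH].
    (* A hyperplane through [p] would be the whole space; [0] and the unit vectors then force its
       normal vector to vanish. *)
    rewrite /flat_set /= in X0.
    have HT q : H q.
      have : [set: V] q by [].
      by rewrite -X0 => /(_ H); apply; rewrite /= BP HA; apply/asboolP.
    have [a [b [aN0 HE]]] := hyperplanesP HA.
    have b0 : b = 0.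
      have := HT 0; rewrite HE /= => <-.
      by rewrite big1 // => i _; rewrite mxE mulr0.
    case/eqP: aN0; apply/rowP => i; rewrite mxE.
    have := HT (delta_mx ord0 i); rewrite HE /= b0 (bigD1 i) //= big1.
      by rewrite !mxE !eqxx mulr1 addr0.
    by move=> j ji; rewrite !mxE (negPf ji) andbF mulr0.
  apply: val_inj => /=; apply/seteqP; split=> // q _ H /=.
  by rewrite BP => /andP[HA /asboolP /(noH _ HA)].
Qed.

(* Abstract finite field method: the points of [F_m ^ n] are replaced by any
   finite family of real points that meets each flat [X] in [m ^ dim X] points. *)
Lemma characteristic_polynomial_horner (T : finType) (p : T -> V) (m : nat) :
  (forall X, X \in flats A -> #|[pred y | `[< X (p y) >]]| = (m ^ dimension X)%N) ->
  (characteristic_polynomial A).[m%:R] =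
    #|[pred y | `[< forall H, H \in hyperplanes A -> ~ H (p y) >]]|%:R.
Proof.
move=> cardX; rewrite /characteristic_polynomial horner_sum.
have dimle (X : set V) : (dimension X <= n)%N.
  by have := dimvS (subvf (@direction R n X)); rewrite dimvf /dim /= mul1n.
transitivity (\sum_(x : L) \sum_(y | `[< flat_set x (p y) >])
    mobius (\bot : L)%O x).
  apply: eq_bigr => x _; rewrite hornerZ hornerXn /flat_rank subKn //.
  rewrite -natrX -cardX ?(valP x) // sumr_const mulr_natr.
  by congr (_ *+ _); apply: eq_card => y; rewrite !inE.
(* With the points outside, each inner sum runs over the interval below the flat of [p y] and is [0]
   unless that flat is the bottom. *)
rewrite (exchange_big_dep predT) //= -sum1_card natr_sum big_mkcond /=.
rewrite [RHS]big_mkcond /=; apply: eq_bigr => y _.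
have [x [lex x0]] := flat_of_point (p y).
rewrite (eq_bigl (fun z => z <= x)%O); last first.
  by move=> z; apply/asboolP/idP => /lex.
rewrite sum_mobius_le inE.
case: eqVneq => [/x0 noH | /eqP xN0]; first by case: asboolP.
by case: asboolP => // /x0.
Qed.

End FiniteFieldMethod.

(** * Hyperplanes of the Catalan arrangement and lifts of residues to real points *)

Section Catalan.
Local Open Scope classical_set_scope.
Variables (R : realType) (n : nat).
Local Notation V := 'rV[R]_n.

(** Swapping [i] and [j] turns the value [-1] into [1], so a boolean encodes the remaining
    values. *)
Lemma catalan_hyperplaneP (H : set V) :
  (H \in hyperplanes (catalan_arrangement R n)) <->
  exists i j (e : bool), i != j /\ H = diff_hyperplane i j e%:R.
Proof.
have oppE (i j : 'I_n) (c : R) : diff_hyperplane i j (- c) = diff_hyperplane j i c.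
  apply/seteqP; split=> x; rewrite /diff_hyperplane /= => xij.
    by rewrite -opprB xij opprK.
  by rewrite -opprB xij.
split=> [/bigfcupP[i _ /bigfcupP[j /andP[_ /andP[_ ltij]]]] | [i [j [e [neij ->]]]]].
  have neij : i != j by rewrite -val_eqE neq_ltn ltij.
  rewrite !inE -orbA => /or3P[] /eqP ->.
  - by exists j, i, true; rewrite eq_sym oppE.
  - by exists i, j, false.
  - by exists i, j, true.
have mem (k l : 'I_n) (c : R) : (k < l)%N -> c \in [:: -1; 0; 1] ->
    diff_hyperplane k l c \in catalan_hyperplanes R n.
  move=> ltkl cP; apply/bigfcupP; exists k; rewrite ?mem_index_enum //.
  apply/bigfcupP; exists l; rewrite ?mem_index_enum ?ltkl //.
  by move: cP; rewrite !inE -orbA => /or3P[] /eqP ->; rewrite eqxx ?orbT.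
have [ltij | ltji | /val_inj eqij] := ltngtP i j; last by rewrite eqij eqxx in neij.
  by apply: mem => //; rewrite !inE; case: e; rewrite eqxx !orbT.
rewrite -[e%:R]opprK oppE; apply: mem => //; rewrite !inE.
by case: e; rewrite ?oppr0 eqxx ?orbT.
Qed.

Variable k : nat.
Hypothesis ltnk : (n < k.+3)%N.
Local Notation T := {ffun 'I_n -> 'I_k.+3}.
Implicit Types y : T.

Lemma missed_value y : exists v, v \notin codom y.
Proof.
apply/existsP; rewrite -negb_forall; apply/negP => /forallP allv.
have : (#|'I_k.+3| <= #|codom y|)%N.
  by apply/subset_leq_card/fintype.subsetP => v _; apply: allv.
by rewrite leqNgt card_ord (leq_ltn_trans (leq_image_card _ _)) ?card_ord.
Qed.

(* Cutting the cycle of residues open at a value missed by [y] makes the real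
   differences [0] and [1] of the lift equivalent to those modulo [k.+3]. *)
Definition cut y : 'I_k.+3 := xchoose (missed_value y).
Definition lift_point y : V := \row_i (val (y i - cut y))%:R.

(** The residues [a] and [b] measured from the cut are nonzero, so [a = b + 1] never arises by
    wrapping from [k.+2] to [0]. *)
Lemma lift_pointP y i j (e : bool) :
  diff_hyperplane i j e%:R (lift_point y) <-> y i - y j = e%:R.
Proof.
have cutN l : y l - cut y != 0.
  rewrite subr_eq0; apply: contraNneq (xchooseP (missed_value y)) => yl.
  by rewrite /cut in yl; rewrite -yl codom_f.
have -> : y i - y j = (y i - cut y) - (y j - cut y).
  by rewrite opprB addrA subrK.
rewrite /diff_hyperplane /= !mxE; move: (cutN i) (cutN j).
move: (y i - cut y) (y j - cut y) => a b aN0 bN0.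
have -> : (a - b = e%:R) <-> a = b + e%:R.
  by split=> [<-|->]; [rewrite addrC subrK | rewrite addrC addKr].
have eqR : ((val a)%:R - (val b)%:R = e%:R :> R) <-> (val a = val b + e)%N.
  split=> [/eqP | ->]; last by rewrite natrD addrC addKr.
  by rewrite subr_eq -natrD eqr_nat addnC => /eqP.
rewrite eqR.
have valE : val (b + e%:R) = ((b + e) %% k.+3)%N.
  by case: e {eqR}; rewrite //= mulr0n addr0 addn0 modn_small.
split=> [ab | ab]; last first.
  rewrite ab valE modn_small //; case: e {eqR} ab valE => ab valE; last by rewrite addn0.
  rewrite addn1 ltn_neqAle ltn_ord andbT; apply: contraNneq aN0 => bk.
  by apply/eqP/val_inj; rewrite ab valE /= addn1 bk modnn.
by apply: val_inj; rewrite valE -ab modn_small // ltn_ord.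
Qed.

End Catalan.

(** * Counting lifted points on flats *)

Section CatalanFlats.
Local Open Scope classical_set_scope.
Variables (R : realType) (n k : nat).
Hypothesis ltnk : (n < k.+3)%N.
Local Notation V := 'rV[R]_n.
Local Notation T := {ffun 'I_n -> 'I_k.+3}.
Local Notation pt := (lift_point R ltnk).

(* When a hyperplane is added to [B], either it is implied by [B], over the reals
   and, through the lifts, modulo [k.+3]; or it cuts one dimension and, since the
   values of [y i - y j] are then equidistributed, a factor [k.+3]. *)
Lemma card_lift_points (B : {fset set V}) (p : V) :
  (forall H, H \in B -> H \in hyperplanes (catalan_arrangement R n)) ->
  (forall H, H \in B -> H p) ->
  exists U : {vspace V},
    (forall u, u \in U <-> forall H, H \in B -> H (p + u)) /\
    #|[pred y : T | `[< forall H, H \in B -> H (pt y) >]]| = (k.+3 ^ \dim U)%N.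
Proof.
elim/fset1U_rect: B => [_ _|H B _ IHB hypB pB].
  exists fullv; split=> [u|]; first by rewrite memvf; split.
  rewrite dimvf /dim /= mul1n (eq_card (B := predT)).
    by rewrite card_ffun !card_ord.
  by move=> y; rewrite !inE; apply/asboolP.
have [||U [BU cardU]] := IHB.
- by move=> H' HB; apply: hypB; rewrite !inE HB orbT.
- by move=> H' HB; apply: pB; rewrite !inE HB orbT.
have [i [j [e [neij HE]]]] := (catalan_hyperplaneP H).1 (hypB H (fset1U1 _ _)).
have Hp : p ord0 i - p ord0 j = e%:R by have := pB H (fset1U1 _ _); rewrite HE.
have HpuE u : H (p + u) <-> u ord0 i = u ord0 j.
  rewrite HE /diff_hyperplane /= !mxE opprD addrACA Hp.
  split=> [/eqP | ->]; last by rewrite subrr addr0.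
  by rewrite -[X in _ == X]addr0 (inj_eq (addrI _)) subr_eq0 => /eqP.
have consE (P : set V -> Prop) :
    (forall H', H' \in (H |` B)%fset -> P H') <-> P H /\ (forall H', H' \in B -> P H').
  split=> [allP | [PH PB] H']; last by rewrite !inE => /orP[/eqP -> | /PB].
  by split=> [|H' HB]; apply: allP; rewrite !inE ?eqxx ?HB ?orbT.
have [Uij | /existsNP[u /not_implyP[uU neu]]] :=
  pselect (forall u, u \in U -> u ord0 i = u ord0 j).
  exists U; split=> [u|].
    rewrite (consE (fun H' => H' (p + u))) -BU.
    by split=> [uU | [_ //]]; split=> //; apply/HpuE/Uij.
  rewrite -cardU; apply: eq_card => y; rewrite !inE; apply/asboolP/asboolP.
    by move/(consE (fun H' => H' (pt y))) => [].
  move=> yB; apply/(consE (fun H' => H' (pt y))); split=> //.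
  rewrite -[pt y](subrKC p); apply/HpuE/Uij/BU => H' HB.
  by rewrite subrKC; apply: yB.
pose phi := linfun (mulmxr (delta_mx i ord0 - delta_mx j ord0) : V -> 'M[R]_1).
have phi0E v : (phi v == 0) = (v ord0 i == v ord0 j).
  have -> : phi v = (v ord0 i - v ord0 j)%:M.
    by apply/matrixP => a b; rewrite !ord1 lfunE /= mulmxBr -!colE !mxE eqxx mulr1n.
  rewrite -[RHS]subr_eq0; apply/eqP/eqP => [/matrixP/(_ ord0 ord0)|->].
    by rewrite !mxE eqxx mulr1n.
  by rewrite raddf0.
exists (U :&: lker phi)%VS; split=> [v|].
  rewrite (consE (fun H' => H' (p + v))) -BU HpuE memv_cap memv_ker phi0E.
  by split=> [/andP[-> /eqP] | [/eqP -> ->]].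
(* The target of [phi] is a line and [phi] is nonzero at [u], so its kernel on [U] loses exactly one
   dimension. *)
have dimU : \dim U = (\dim (U :&: lker phi)).+1.
  rewrite -(limg_ker_dim phi U) -[RHS]addn1; congr (_ + _)%N.
  have := dimvS (subvf (phi @: U)%VS); rewrite dimvf /dim /= mul1n => le1.
  apply/eqP; rewrite eqn_leq le1 lt0n dimv_eq0; apply: contra_notN neu => /eqP phi0.
  by have := memv_img phi uU; rewrite phi0 memv0 phi0E => /eqP.
(* Translating by the indicator of the component of [i] shifts [y i - y j]. *)
pose shift (z : 'I_k.+3) (y : T) : T :=
  [ffun l => y l + (if u ord0 l == u ord0 i then z else 0)].
have shiftK z : cancel (shift z) (shift (- z)).
  by move=> y; apply/ffunP => l; rewrite !ffunE; case: ifP; rewrite ?addr0 ?addrK.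
have shiftB z y H' : H' \in B -> H' (pt y) -> H' (pt (shift z y)).
  move=> HB.
  have HH : H' \in (H |` B)%fset by rewrite !inE HB orbT.
  have [a [b [d [_ H'E]]]] := (catalan_hyperplaneP H').1 (hypB _ HH).
  (* Both [p] and [p + u] lie on [H'], so the shift moves [y a] and [y b] by the same amount. *)
  have uab : u ord0 a = u ord0 b.
    have := (BU u).1 uU _ HB; have := pB _ HH; rewrite H'E /diff_hyperplane /=.
    move=> <-; rewrite !mxE opprD addrACA => /eqP.
    by rewrite -[X in _ == X]addr0 (inj_eq (addrI _)) subr_eq0 => /eqP.
  rewrite H'E => /lift_pointP yab; apply/lift_pointP; rewrite !ffunE uab.
  by rewrite opprD addrACA subrr addr0.
pose SB := [pred y : T | `[< forall H', H' \in B -> H' (pt y) >]].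
have shiftSB z y : (shift z y \in SB) = (y \in SB).
  apply/asboolP/asboolP => yB H' HB; last by apply: shiftB (yB _ HB).
  by rewrite -(shiftK z y); apply: shiftB (yB _ HB).
pose fib (z : 'I_k.+3) := #|[pred y : T | (y \in SB) && (y i - y j == z)]|.
have fibE z : fib z = fib e%:R.
  rewrite /fib -!sum1_card (reindex_onto (shift (z - e%:R)) (shift (- (z - e%:R)))).
    apply: eq_bigl => y; rewrite !inE shiftK eqxx andbT.
    congr (_ && _); first exact: shiftSB.
    rewrite !ffunE eqxx [u ord0 j == _]eq_sym.
    have /negPf -> : u ord0 i != u ord0 j by apply/eqP => /neu.
    by rewrite addr0 addrAC addrCA -[X in _ == X]addr0 (inj_eq (addrI _)) subr_eq0.
  by move=> y _; rewrite -{1}[z - _]opprK shiftK.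
have cardSB : #|SB| = (k.+3 * fib e%:R)%N.
  rewrite -sum1_card (partition_big (fun y : T => y i - y j) predT) //=.
  rewrite (eq_bigr (fun=> fib e%:R)) ?sum_nat_const ?card_ord // => z _.
  by rewrite -(fibE z) /fib -sum1_card; apply: eq_bigl => y; rewrite !inE.
move: cardU; rewrite dimU expnS -[LHS]/#|SB| cardSB => /eqP.
rewrite eqn_pmul2l // => /eqP <-; apply: eq_card => y; rewrite !inE.
apply/asboolP/andP => [/(consE (fun H' => H' (pt y)))[Hy yB] | [/asboolP yB /eqP yij]].
  split; first exact/asboolP.
  by move: Hy; rewrite HE => /lift_pointP ->.
by apply/(consE (fun H' => H' (pt y))); split=> //; rewrite HE; apply/lift_pointP.
Qed.

(** The subspace found for [B] is the direction of [X] by [direction_unique]. *)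
Lemma card_lift_points_flat (X : set V) :
  X \in flats (catalan_arrangement R n) ->
  #|[pred y : T | `[< X (pt y) >]]| = (k.+3 ^ dimension X)%N.
Proof.
case/flatsP => B [BA XB [p Xp]].
have hypB H : H \in B -> H \in hyperplanes (catalan_arrangement R n).
  exact: (fsubsetP BA).
have pB H : H \in B -> H p by rewrite XB in Xp; exact: Xp.
have [U [BU cardU]] := card_lift_points hypB pB.
have XU : X = [set p + u | u in [set` U]].
  rewrite XB; apply/seteqP; split=> [x Bx | x [u /= uU <-]]; last exact/BU.
  exists (x - p); last by rewrite subrKC.
  by apply/BU => H HB; rewrite subrKC; apply: Bx.
by rewrite /dimension (direction_unique XU) -cardU XB; apply: eq_card => y; rewrite !inE.
Qed.

Lemma catalan_charpoly_horner :
  (characteristic_polynomial (catalan_arrangement R n)).[k.+3%:R] =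
  #|[pred y : T | [forall i, forall j, (i != j) ==>
       (y i != y j) && (y i - y j != 1)]]|%:R.
Proof.
rewrite (characteristic_polynomial_horner card_lift_points_flat).
congr (_%:R); apply: eq_card => y; rewrite !inE; apply/asboolP/forallP.
  move=> noH i; apply/forallP => j; apply/implyP => neij; apply/andP; split.
    rewrite -subr_eq0; apply/eqP => yij; apply: (noH (diff_hyperplane i j false%:R)).
      by apply/catalan_hyperplaneP; exists i, j, false.
    exact/lift_pointP.
  apply/eqP => yij; apply: (noH (diff_hyperplane i j true%:R)).
    by apply/catalan_hyperplaneP; exists i, j, true.
  exact/lift_pointP.
move=> ally H /catalan_hyperplaneP[i [j [e [neij ->]]]] /lift_pointP yij.
have /forallP/(_ j)/implyP/(_ neij)/andP[/eqP ne0 /eqP ne1] := ally i.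
by case: e yij => // /eqP; rewrite subr_eq0 => /eqP.
Qed.

End CatalanFlats.

(** * Comparison of polynomials at large integers, and the conclusion *)

Lemma poly_eq_nat (K : numDomainType) (p q : {poly K}) (m0 : nat) :
  (forall m, (m0 <= m)%N -> p.[m%:R] = q.[m%:R]) -> p = q.
Proof.
move=> pq; apply/eqP; rewrite -subr_eq0; apply/eqP.
(* As many distinct roots as the size of the difference, one more than its degree allows if it is
   nonzero. *)
pose s := [seq (m0 + i)%N%:R : K | i <- iota 0 (size (p - q))].
apply: (@roots_geq_poly_eq0 _ _ s); last by rewrite size_map size_iota.
  apply/allP => _ /mapP[i _ ->].
  by rewrite rootE hornerD hornerN pq ?leq_addr // subrr.
rewrite map_inj_uniq ?iota_uniq // => i j /eqP.
by rewrite eqr_nat eqn_add2l => /eqP.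
Qed.

Lemma catalan_egf_powq (R : realType) : catalan_egf R = fps_powq catalan_root.
Proof.
(* From [n.+3] on, [m] has the form [k.+3] with [n < k.+3], as the lifts and the coefficient formula
   require. *)
apply: fpsP => n; apply: (@poly_eq_nat _ _ _ n.+3) => m lem.
have [k mE] : exists k, m = k.+3 by exists (m - 3)%N; lia.
subst m; have ltnk : (n < k.+3)%N by lia.
have -> : (fps_powq catalan_root n).[k.+3%:R] = (catalan_root ^+ k.+3) n.
  by rewrite -(fps_powq_horner k.+3 catalan_root_coef0).
rewrite catalan_root_exp_coef // fps_coefD fps_coefXM.
rewrite [catalan_egf R n]/((n`!%:R)^-1 *: map_poly intr _) hornerZ.
have -> : (k.+3%:R : rat) = (k.+3%:R : int)%:~R by rewrite rmorph_nat.
rewrite horner_map /=.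
rewrite (catalan_charpoly_horner R ltnk) card_separated_tuples.
rewrite rmorph_nat natrM mulKf ?pnatr_eq0 -?lt0n ?fact_gt0 // natrD.
by rewrite A_series_coef; case: n {lem ltnk} => [|n]; rewrite ?A_series_coef.
Qed.

Theorem theorem4p18 (R : realType) :
  (exists F : fps rat,
     [/\ fps_cvg (fun r : nat => A_series r / A_series r.-1) F,
         F 0%N = 1
       & catalan_egf R = fps_powq F])
  /\ tofrac (fps_sqrt (1 + 4%:R * fpsX rat) - 1) / tofrac (2%:R * fpsX rat)
       = tofrac alternating_catalan_series
  /\ fps_cvg (fun r : nat => A_series r.-1 / A_series r)
       alternating_catalan_series.
Proof.
split; last first.
  by split; [exact: sqrt_catalan_quotient | exact: A_series_inv_ratio_cvg].
exists catalan_root; split; last exact: catalan_egf_powq.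
  exact: A_series_ratio_cvg.
exact: catalan_root_coef0.
Qed.
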